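(* Let $K$ be a finite field, let $G$ be a graph and let $X$ be the projective toric subset parameterized by $G$. Let $v_1$ and $v_2$ be two (distinct) vertices of $G$ such that $\{v_1,v_2\}$ is a non-edge of $G$. Let $G'$ be the graph obtained from $G$ by identifying $v_1$ with $v_2$, and denote by $X'$ the projective toric subset parameterized by $G'$. Then $$\operatorname{reg} K[E_G]/I(X)\geq \operatorname{reg} K[E_{G'}]/I(X').$$
   Context: Graphs are finite, undirected and without loops; multiple edges are allowed. $V_G$ and $E_G$ denote the vertex set and edge set of $G$; it is assumed that $G$ has at least one edge and no isolated vertices. Identifying $v_1$ with $v_2$ keeps all edges, so $G'$ has the same number of edges as $G$ (possibly with new multiple edges). For a graph $G$ with $s=|E_G|\geq 1$ edges, fix an identification of $E_G$ with the variables $t_1,\dots,t_s$ of the standard graded polynomial ring $K[t_1,\dots,t_s]$, which is then denoted $K[E_G]$. For $\mathbf{x}=(x_v)_{v\in V_G}\in (K^* )^{V_G}$ and an edge $t_i=\{v,w\}$ put $\mathbf{x}^{t_i}=x_vx_w$. The projective toric subset parameterized by $G$ is $$X=\{(\mathbf{x}^{t_1},\dots,\mathbf{x}^{t_s})\in \mathbb{P}^{s-1}(K) \mid \mathbf{x}\in (K^* )^{V_G}\},$$ and $I(X)\subset K[E_G]$ is its vanishing ideal, i.e. the ideal generated by all homogeneous polynomials vanishing on $X$. The Castelnuovo--Mumford regularity of a finitely generated graded module $M$ over a standard graded polynomial ring $S$, with minimal graded free resolution $0\to F_c\to\cdots\to F_0\to M\to 0$, $F_i\cong\bigoplus_{j}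 S(-j)^{b_{ij}}$, is $\operatorname{reg} M=\max\{j-i \mid b_{ij}\neq 0\}$. *)

(* Defs.v *)
From HB Require Import structures.
From mathcomp Require Import all_boot all_order all_algebra.
From mathcomp Require Import mpoly.

Set Implicit Arguments.
Unset Strict Implicit.
Unset Printing Implicit Defensive.

Import Order.TTheory GRing.Theory Num.Theory.
Local Open Scope ring_scope.

(* The edges are the labels in 'I_nedges, so that the edge e is the variable
   'X_e of {mpoly K[nedges]}; distinct labels may have the same endpoints. *)
Record multigraph := Multigraph {
  vertex : finType;
  nedges : nat;
  ends : 'I_nedges -> {set vertex};
  card_ends : forall e, #|ends e| = 2%N;
  nedges_gt0 : (0 < nedges)%N;
  no_isolated : forall v, exists e, v \in ends e
}.

Definition adjacent (G : multigraph) (v w : vertex G) : bool :=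
  [exists e : 'I_(nedges G), ends e == [set v; w]].

Section Identify.
Variables (G : multigraph) (v1 v2 : vertex G).
Hypotheses (v12 : v1 != v2) (nadj : ~~ adjacent v1 v2).

Definition identify_vertex : finType := {v : vertex G | v != v2}.

(* v2 is sent to v1, every other vertex to itself: see val_identify_proj *)
Definition identify_proj (v : vertex G) : identify_vertex :=
  insubd (exist (fun v => v != v2) v1 v12) v.

Lemma val_identify_proj v :
  val (identify_proj v) = if v == v2 then v1 else v.
Proof. by rewrite /identify_proj val_insubd; case: eqP. Qed.

Definition identify_ends (e : 'I_(nedges G)) : {set identify_vertex} :=
  identify_proj @: ends e.

Lemma card_identify_ends e : #|identify_ends e| = 2%N.
Proof.
have nends : ~~ ((v1 \in ends e) && (v2 \in ends e)).
  apply: contra nadj => /andP[v1e v2e]; apply/existsP; exists e.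
  by rewrite eq_sym eqEcard subUset !sub1set v1e v2e card_ends cards2 v12.
rewrite -(card_ends e) card_in_imset // => a b ae be /(congr1 val).
rewrite !val_identify_proj.
case: eqP => [av | _]; case: eqP => [bv | _] // ab; first by rewrite av bv.
- by case/negP: nends; rewrite ab be -av ae.
- by case/negP: nends; rewrite -ab ae -bv be.
Qed.

Lemma identify_no_isolated v : exists e, v \in identify_ends e.
Proof.
have [e ve] := no_isolated (val v); exists e.
apply/imsetP; exists (val v) => //; apply: val_inj.
by rewrite val_identify_proj (negbTE (valP v)).
Qed.

Definition identify : multigraph :=
  Multigraph card_identify_ends (nedges_gt0 G) identify_no_isolated.

End Identify.

Section ToricIdeal.
Variables (K : fieldType) (G : multigraph).

Definition edge_monomial (x : vertex G -> K) (e : 'I_(nedges G)) : K :=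
  \prod_(v in ends e) x v.

(* A subset of P^(s-1)(K) is given by the set of all the homogeneous
   coordinate vectors of its points; it is closed under scaling by K^*. *)
Definition toric_set (y : 'I_(nedges G) -> K) : Prop :=
  exists2 x : vertex G -> K, forall v, x v != 0 &
  exists2 c : K, c != 0 & forall e, y e = c * edge_monomial x e.

Definition homog_vanishing (f : {mpoly K[nedges G]}) : Prop :=
  (exists d : nat, f \is d.-homog) /\ forall y, toric_set y -> f.@[y] = 0.

Definition vanishing_ideal (f : {mpoly K[nedges G]}) : Prop :=
  exists (m : nat) (a g : 'I_m -> {mpoly K[nedges G]}),
    (forall k, homog_vanishing (g k)) /\ f = \sum_(k < m) a k * g k.

End ToricIdeal.

Section Regularity.
Variables (K : fieldType) (s : nat).
Local Notation S := {mpoly K[s]}.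

Definition homogz (d : int) (f : S) : Prop :=
  match d with Posz n => f \is n.-homog | Negz _ => f = 0 end.

(* Minimal graded free resolution of S/I, for a homogeneous ideal I of S.
   F_i is the module of row vectors of length res_rank i over S, in which the
   b-th basis vector is homogeneous of degree res_shift i b, i.e. F_i is the
   direct sum of the S(- res_shift i b).  Matrices act on the right.  The
   augmentation F_0 -> S/I is given by representatives in S of the images of
   the basis vectors.  Exactness at F_i with F_(i+1) = 0 is injectivity. *)
Record min_resolution (I : S -> Prop) := MinResolution {
  res_rank : nat -> nat;
  res_shift : forall i, 'I_(res_rank i) -> int;
  res_aug : 'cV[S]_(res_rank 0);
  res_diff : forall i, 'M[S]_(res_rank i.+1, res_rank i);
  res_aug_graded : forall a, homogz (res_shift a) (res_aug a 0);
  res_diff_graded : forall i a b,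
    homogz (res_shift a - res_shift b) (res_diff i a b);
  res_aug_surj : forall f : S, exists u : 'rV[S]_(res_rank 0), I (f - (u *m res_aug) 0 0);
  res_exact0 : forall u : 'rV[S]_(res_rank 0),
    I ((u *m res_aug) 0 0) <-> exists w : 'rV[S]_(res_rank 1), u = w *m res_diff 0;
  res_exact : forall i (u : 'rV[S]_(res_rank i.+1)),
    u *m res_diff i = 0 <-> exists w : 'rV[S]_(res_rank i.+2), u = w *m res_diff i.+1;
  (* minimality: the image of F_(i+1) lies in (X_1, ..., X_s) F_i *)
  res_minimal : forall i a b, (res_diff i a b)@_0%MM = 0;
  res_finite : exists c, forall i, (c < i)%N -> res_rank i = 0%N
}.

Definition betti (I : S -> Prop) (F : min_resolution I) (i : nat) (j : int) :=
  #|[set b : 'I_(res_rank F i) | res_shift b == j]|.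

(* r = reg S/I *)
Definition is_regularity (I : S -> Prop) (r : int) : Prop :=
  exists F : min_resolution I,
    (exists i j, betti F i j != 0%N /\ j - i%:Z = r) /\
    (forall i j, betti F i j != 0%N -> j - i%:Z <= r).

End Regularity.

(* Main.v *)
From HB Require Import structures.
Require Import Defs.
From mathcomp Require Import all_boot all_order all_algebra.
From mathcomp Require Import finfield mpoly ring.

(** A homogeneous ideal I for which the variable x = X_k is a nonzerodivisor on
    S/I satisfies reg S/I <= r if and only if S/(I, x) vanishes in all degrees
    d > r, provided it vanishes in large degrees.  As I(X) is contained in
    I(X'), the vanishing passes from S/(I(X), x) to S/(I(X'), x).

    The equivalence goes through the Koszul homology H_q(S/I) of all variables,
    whose degree j part vanishes exactly when F_q has no generator of degree j
    (dimension shifting along the resolution F).  If S/(I, x) vanishes in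
    degrees > r, a Koszul cycle c of degree > q + r is x b modulo I with b a
    cycle, hence the boundary of e_k /\ b.  Conversely, if (S/(I, x))_(d+1) = 0
    and z has degree d, then X_i z = x y_i modulo I, and the y_i are the
    coefficients of a cycle in H_(s-1), of degree d + s - 1; when it is a
    boundary, z is in (I, x).

    For finite K, X_i^|K| - x^(|K|-1) X_i lies in I(X), so S/(I(X), x) vanishes
    in large degrees. *)

Set Implicit Arguments.
Unset Strict Implicit.
Unset Printing Implicit Defensive.

Import Order.TTheory GRing.Theory Num.Theory.
Local Open Scope ring_scope.

Lemma fin_choice_on (T : finType) (U : Type) (u0 : U) (D : pred T) (P : T -> U -> Prop) :
  (forall x, D x -> exists u, P x u) -> exists f : T -> U, forall x, D x -> P x (f x).
Proof.
move=> H; apply: (fin_all_exists (P := fun x u => D x -> P x u)) => x.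
by case: (boolP (D x)) => [/H[u Pu]|_]; [exists u | exists u0].
Qed.

(** * Homogeneous components of polynomials in integer degrees *)

Section HomogeneousComponents.
Variables (K : fieldType) (s : nat).
Local Notation S := {mpoly K[s]}.
Implicit Types (f g : S) (d e : int).

Lemma homogzP d f : homogz d f <-> forall m, m \in msupp f -> (mdeg m)%:Z = d.
Proof.
case: d => d /=.
  by split=> [/dhomogP h m /h -> //|h]; apply/dhomogP=> m /h [].
split=> [-> m|h]; first by rewrite msupp0.
apply/eqP; rewrite -msupp_eq0; case: (msupp f) h => // m l /(_ m).
by rewrite inE eqxx => /(_ isT).
Qed.

Lemma homogz0 d : homogz d (0 : S).
Proof. by apply/homogzP => m; rewrite msupp0. Qed.

Lemma homogzD d f g : homogz d f -> homogz d g -> homogz d (f + g).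
Proof.
move=> /homogzP hf /homogzP hg; apply/homogzP => m /msuppD_le.
by rewrite mem_cat => /orP[/hf|/hg].
Qed.

Lemma homogz_sum d (I : Type) (r : seq I) (P : pred I) (F : I -> S) :
  (forall i, P i -> homogz d (F i)) -> homogz d (\sum_(i <- r | P i) F i).
Proof. by move=> h; elim/big_ind: _ => //; [exact: homogz0 | exact: homogzD]. Qed.

Lemma homogzM d e f g : homogz d f -> homogz e g -> homogz (d + e) (f * g).
Proof.
move=> /homogzP hf /homogzP hg; apply/homogzP => m.
move=> /msuppM_le /allpairsP[[m1 m2] /= [/hf <- /hg <- ->]].
by rewrite mdegD.
Qed.

Lemma homogzX (k : 'I_s) : homogz 1 ('X_k : S).
Proof. by rewrite /= dhomogX; apply/eqP; apply: mdeg1. Qed.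

Lemma homogz_sign n : homogz 0 ((-1) ^+ n : S).
Proof.
by rewrite /= -signr_odd; case: odd; rewrite ?expr0 ?expr1 ?rpredN; exact: dhomog1.
Qed.

Lemma homogz_coef0 d f : homogz d f -> d != 0 -> f@_0%MM = 0.
Proof.
move=> /homogzP hf d0; apply: memN_msupp_eq0; apply: contra d0 => /hf <-.
by rewrite mdeg0.
Qed.

Definition hcomp d f : S := if d is Posz n then pihomog mdeg n f else 0.

Fact hcomp_is_linear d : linear (hcomp d).
Proof. by case: d => n c f g /=; [rewrite linearP | rewrite scaler0 addr0]. Qed.

HB.instance Definition _ d :=
  GRing.isLinear.Build K S S _ (hcomp d) (hcomp_is_linear d).

Lemma hcomp_homogz d f : homogz d (hcomp d f).
Proof. by case: d => n //=; apply: pihomogP. Qed.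

Lemma hcomp_id d f : homogz d f -> hcomp d f = f.
Proof. by case: d => n /=; [exact: pihomog_dE | move->]. Qed.

Lemma hcomp_neq d e f : homogz e f -> e != d -> hcomp d f = 0.
Proof.
case: d e => [d|//] [e|e] /=; last by move=> -> _; rewrite pihomog0.
by move=> hf ed; apply: pihomog_ne0 hf.
Qed.

Lemma hcompMr d e f g : homogz e g -> hcomp d (f * g) = hcomp (d - e) f * g.
Proof.
move=> hg; rewrite [f]mpolyE mulr_suml !raddf_sum /= mulr_suml.
apply: eq_bigr => m _.
have hm : homogz (mdeg m)%:Z (f@_m *: 'X_[m]) by rewrite /= rpredZ // dhomogX.
case: (eqVneq (mdeg m)%:Z (d - e)) => [dE|dN].
  rewrite -dE (hcomp_id hm) hcomp_id //.
  by rewrite -[d](subrK e) -dE; apply: homogzM.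
rewrite (hcomp_neq hm) // (@hcomp_neq _ ((mdeg m)%:Z + e)) ?mul0r //.
  exact: homogzM.
by apply: contra dN => /eqP <-; rewrite addrK.
Qed.

Lemma hcomp_sum f : f = \sum_(d < msize f) hcomp d f.
Proof. by rewrite {1}(pihomog_partitionE (leqnn (msize f))). Qed.

End HomogeneousComponents.

(** * Graded free modules and degree-preserving matrices *)

Section GradedVectors.
Variables (K : fieldType) (s : nat).
Local Notation S := {mpoly K[s]}.

(** An element of degree [d] of the direct sum of the modules [S(- sh b)]. *)
Definition vhomog n (sh : 'I_n -> int) (d : int) (u : 'rV[S]_n) :=
  forall b, homogz (d - sh b) (u 0 b).

Definition vcomp n (sh : 'I_n -> int) (d : int) (u : 'rV[S]_n) : 'rV[S]_n :=
  \row_b hcomp (d - sh b) (u 0 b).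

Lemma vcomp_vhomog n (sh : 'I_n -> int) d u : vhomog sh d (vcomp sh d u).
Proof. by move=> b; rewrite mxE; apply: hcomp_homogz. Qed.

Lemma vcomp_id n (sh : 'I_n -> int) d u : vhomog sh d u -> vcomp sh d u = u.
Proof. by move=> h; apply/rowP=> b; rewrite mxE hcomp_id. Qed.

Fact vcomp_is_additive n (sh : 'I_n -> int) d : additive (vcomp sh d).
Proof. by move=> u v; apply/rowP=> b; rewrite !mxE raddfB. Qed.

HB.instance Definition _ n (sh : 'I_n -> int) d :=
  GRing.isAdditive.Build _ _ (vcomp sh d) (vcomp_is_additive sh d).

Lemma vcompZ n (sh : 'I_n -> int) d e f u :
  homogz e f -> vcomp sh d (f *: u) = f *: vcomp sh (d - e) u.
Proof.
by move=> hf; apply/rowP=> b; rewrite !mxE mulrC (hcompMr _ _ hf) mulrC addrAC.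
Qed.

Lemma vhomogZ n (sh : 'I_n -> int) d e f u :
  homogz e f -> vhomog sh d u -> vhomog sh (d + e) (f *: u).
Proof. by move=> hf hu b; rewrite mxE mulrC addrAC; apply: homogzM. Qed.

Lemma vhomog_sum n (sh : 'I_n -> int) d (I : Type) (r : seq I) (P : pred I)
    (F : I -> 'rV[S]_n) :
  (forall i, P i -> vhomog sh d (F i)) -> vhomog sh d (\sum_(i <- r | P i) F i).
Proof. by move=> h b; rewrite summxE; apply: homogz_sum => i /h. Qed.

Section GradedMatrix.
Variables (n p : nat) (shn : 'I_n -> int) (shp : 'I_p -> int) (P : 'M[S]_(n, p)).
Hypothesis P_graded : forall a b, homogz (shn a - shp b) (P a b).

Lemma vcomp_mulmx d u : vcomp shp d (u *m P) = vcomp shn d u *m P.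
Proof.
apply/rowP=> b; rewrite !mxE raddf_sum; apply: eq_bigr => a _ /=.
by rewrite mxE (hcompMr _ _ (P_graded a b)) opprB addrA subrK.
Qed.

Lemma vhomog_mulmx d u : vhomog shn d u -> vhomog shp d (u *m P).
Proof. by move=> /vcomp_id <-; rewrite -vcomp_mulmx; apply: vcomp_vhomog. Qed.

End GradedMatrix.
End GradedVectors.

(** * The Koszul differential and exterior multiplication *)

Section Koszul.
Variables (K : fieldType) (s : nat).
Local Notation S := {mpoly K[s]}.
Implicit Types (A B : {set 'I_s}) (k l : 'I_s).

Definition nbelow k A := #|[set a in A | (a < k)%N]|.

Lemma nbelowU1 k l A : l \notin A -> nbelow k (l |: A) = ((l < k) + nbelow k A)%N.
Proof.
move=> lA; rewrite /nbelow; case: ltnP => lk.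
  rewrite (_ : [set a in _ | _] = l |: [set a in A | (a < k)%N]).
    by rewrite cardsU1 inE (negbTE lA).
  by apply/setP=> a; rewrite !inE; case: eqVneq => [->|]; rewrite ?lk.
congr #|pred_of_set _|; apply/setP=> a; rewrite !inE.
by case: eqVneq => // ->; rewrite (negbTE lA) ltnNge lk.
Qed.

(** For [k] outside [A], [e_k /\ e_A] is [ksign k A] times [e_(k |: A)]. *)
Definition ksign k A : S := (-1) ^+ nbelow k A.

(** Anticommutativity of [e_k] and [e_l] in front of [e_A]. *)
Lemma ksign_swap k l A : k != l -> k \notin A -> l \notin A ->
  ksign k (l |: A) * ksign l A = - (ksign l (k |: A) * ksign k A).
Proof.
move=> kl kA lA; rewrite /ksign !nbelowU1 // !exprD.
have : (k != l :> nat) by []; rewrite neq_ltn => /orP[] h.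
  by rewrite h ltnNge (ltnW h) /=; ring.
by rewrite h ltnNge (ltnW h) /=; ring.
Qed.

Lemma ksignK k A : ksign k A * ksign k A = 1.
Proof. by rewrite /ksign -expr2 sqrr_sign. Qed.

Section Differential.
Variable V : lmodType S.
Implicit Types (c : {set 'I_s} -> V).

(* [c] encodes the Koszul chain with coefficient [c A] on the exterior monomial
   e_A; chains are not required to be concentrated in a single [#|A|]. *)
Definition koszul c A : V := \sum_(k | k \notin A) (ksign k A * 'X_k) *: c (k |: A).

(** Left multiplication by [e_k] in the exterior algebra, read off at [e_A]. *)
Definition wedge k c A : V :=
  if k \in A then ksign k (A :\ k) *: c (A :\ k) else 0.

Lemma koszulK c A : koszul (koszul c) A = 0.
Proof.
pose a k l := (ksign k A * 'X_k * (ksign l (k |: A) * 'X_l)) *: c (l |: (k |: A)).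
have aN k l : k != l -> k \notin A -> l \notin A -> a k l = - a l k.
  move=> kl kA lA; rewrite /a -scaleNr setUCA; congr (_ *: _).
  have := ksign_swap kl kA lA.
  set x := ksign k (_ |: _) * _; set y := ksign l _ * _ => xy.
  transitivity (y * ('X_k * 'X_l)); first by rewrite /y; ring.
  by rewrite -[y]opprK -xy /x; ring.
have -> : koszul (koszul c) A =
    \sum_(k | k \notin A) \sum_(l | (l \notin A) && (l != k)) a k l.
  apply: eq_bigr => k kA; rewrite scaler_sumr; apply: eq_big => [l|l _].
    by rewrite !inE negb_or andbC.
  by rewrite scalerA.
(* Exchanging the sums in one of the two halves pairs [a k l] with [a l k]. *)
transitivity (\sum_(k | k \notin A) (\sum_(l | (l \notin A) && (l < k)%N) a k l
   + \sum_(l | (l \notin A) && (k < l)%N) a k l)).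
  apply: eq_bigr => k kA; rewrite (bigID (fun l : 'I_s => (l < k)%N)) /=; congr (_ + _).
    apply: eq_bigl => l; rewrite -andbA; congr (_ && _); case: (ltnP l k) => lk.
      by rewrite andbT; apply: contraTneq lk => ->; rewrite ltnn.
    by rewrite andbF.
  apply: eq_bigl => l; rewrite -andbA; congr (_ && _).
  by rewrite -leqNgt ltn_neqAle eq_sym.
rewrite big_split /=; apply/eqP; rewrite addr_eq0; apply/eqP.
rewrite (exchange_big_dep (fun l => l \notin A)) /=; last by move=> k l _ /andP[].
rewrite -sumrN; apply: eq_bigr => l lA; rewrite -sumrN; apply: eq_big => [k|k].
  by rewrite lA.
move=> /andP[kA /andP[_ lk]]; apply: aN => //.
by apply: contraTneq lk => ->; rewrite ltnn.
Qed.

(** The differential is an antiderivation sending [e_k] to [X_k]. So multiplication by [X_k] is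
    null-homotopic, with homotopy [e_k /\ -]. *)
Lemma koszul_wedge k c A :
  koszul (wedge k c) A + wedge k (koszul c) A = 'X_k *: c A.
Proof.
rewrite /koszul /wedge; case: ifPn => kA; last first.
  rewrite addr0 (bigD1 k) //= big1 => [|l /andP[lA lk]].
    rewrite addr0 setU11 scalerA setU1K //.
    by rewrite mulrAC ksignK mul1r.
  by rewrite !inE (negbTE kA) orbF eq_sym (negbTE lk) scaler0.
set B := A :\ k; have kB : k \notin B by rewrite !inE eqxx.
have AE : A = k |: B by rewrite setD1K.
(* The term of index [k] in the second sum gives ['X_k *: c A]; the terms with [l] outside [A]
   cancel between the two sums. *)
rewrite [X in _ + _ *: X](bigD1 k) //= scalerDr scalerA mulrA ksignK mul1r -AE.
rewrite addrCA -[RHS]addr0; congr (_ + _).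
rewrite scaler_sumr [X in _ + X](eq_bigl (fun l => l \notin A)); last first.
  by move=> l; rewrite AE !inE negb_or andbC.
rewrite -big_split /= big1 // => l lA.
have lk : k != l by apply: contraNneq lA => <-.
have lB : l \notin B by apply: contra lA; rewrite !inE => /andP[].
rewrite !inE kA orbT.
rewrite (_ : (l |: A) :\ k = l |: B); last first.
  by apply/setP=> a; rewrite !inE; case: (eqVneq a l) => [->|//]; rewrite eq_sym lk.
rewrite !scalerA -scalerDl.
have := ksign_swap lk kB lB; rewrite -AE.
set x := ksign k (_ |: _) * _; set y := ksign l _ * _ => xy.
rewrite (_ : _ + _ = 0) ?scale0r //.
have -> : ksign l A * 'X_l * ksign k (l |: B) =
   'X_l * ksign l B * (ksign l A * ksign k (l |: B) * ksign l B).
  transitivity ('X_l * ksign l A * ksign k (l |: B) * (ksign l B * ksign l B)).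
    by rewrite ksignK; ring.
  by ring.
rewrite (_ : ksign l A * ksign k (l |: B) * ksign l B = ksign l A * x);
  last by rewrite /x; ring.
rewrite xy /y.
transitivity ('X_l * ksign l B * ksign k B * (1 - ksign l A * ksign l A)); first by ring.
by rewrite ksignK subrr mulr0.
Qed.

End Differential.
End Koszul.

(** * Exactness of the Koszul complex of a free module *)

Section KoszulExact.
Variables (K : fieldType) (s : nat).
Local Notation S := {mpoly K[s]}.
Implicit Types (A B : {set 'I_s}) (k l : 'I_s).

Lemma koszulB (V : lmodType S) (c c' : {set 'I_s} -> V) A :
  koszul (fun B => c B - c' B) A = koszul c A - koszul c' A.
Proof. by rewrite /koszul -sumrB; apply: eq_bigr => k _; rewrite scalerBr. Qed.

Lemma koszulD (V : lmodType S) (c c' : {set 'I_s} -> V) A :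
  koszul (fun B => c B + c' B) A = koszul c A + koszul c' A.
Proof. by rewrite /koszul -big_split; apply: eq_bigr => k _; rewrite scalerDr. Qed.

Lemma eq_koszul (V : lmodType S) (c c' : {set 'I_s} -> V) q A :
  #|A| = q -> (forall B, #|B| = q.+1 -> c B = c' B) -> koszul c A = koszul c' A.
Proof. by move=> Aq cc'; apply: eq_bigr => k kA; rewrite cc' // cardsU1 kA Aq. Qed.

Lemma koszul_mulmx n p (P : 'M[S]_(n, p)) (c : {set 'I_s} -> 'rV[S]_n) A :
  koszul (fun B => c B *m P) A = koszul c A *m P.
Proof. by rewrite mulmx_suml; apply: eq_bigr => k _; rewrite scalemxAl. Qed.

Lemma ksign_homogz k A : homogz 1 (ksign K k A * 'X_k).
Proof. by rewrite -[1]add0r; apply: homogzM; [exact: homogz_sign | exact: homogzX]. Qed.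

Lemma koszul_vcomp n (sh : 'I_n -> int) d (c : {set 'I_s} -> 'rV[S]_n) A :
  koszul (fun B => vcomp sh (d - 1) (c B)) A = vcomp sh d (koszul c A).
Proof.
rewrite [RHS]raddf_sum; apply: eq_bigr => k _ /=.
by rewrite (vcompZ _ _ _ (ksign_homogz k A)).
Qed.

(** With [e_A] placed in degree [#|A|], the differential preserves the degree [d] of a chain. *)
Lemma koszul_vhomog n (sh : 'I_n -> int) d q (c : {set 'I_s} -> 'rV[S]_n) A :
  (forall B, #|B| = q.+1 -> vhomog sh (d - q.+1%:Z) (c B)) -> #|A| = q ->
  vhomog sh (d - q%:Z) (koszul c A).
Proof.
move=> hc Aq; apply: vhomog_sum => k kA.
rewrite (_ : d - q%:Z = (d - q.+1%:Z) + 1); last by rewrite -addn1 PoszD; ring.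
by apply: vhomogZ (ksign_homogz k A) _; apply: hc; rewrite cardsU1 kA Aq.
Qed.

Definition free_of n k (u : 'rV[S]_n) :=
  forall b m, m \in msupp (u 0 b) -> m k = 0%N.

Lemma free_of0 n k : free_of k (0 : 'rV[S]_n).
Proof. by move=> b m; rewrite mxE msupp0. Qed.

Lemma free_ofD n k (u v : 'rV[S]_n) : free_of k u -> free_of k v -> free_of k (u + v).
Proof.
by move=> hu hv b m; rewrite mxE => /msuppD_le; rewrite mem_cat => /orP[/hu|/hv].
Qed.

Lemma free_ofZX n k l A (u : 'rV[S]_n) :
  k != l -> free_of k u -> free_of k ((ksign K l A * 'X_l) *: u).
Proof.
move=> kl hu b m; rewrite mxE /ksign -signr_odd.
have h (f : S) : (forall m, m \in msupp f -> m k = 0%N) ->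
    m \in msupp ('X_l * f) -> m k = 0%N.
  move=> hf; rewrite mulrC (perm_mem (msuppMX _ _)) => /mapP[m' /hf m'k ->].
  by rewrite mnmDE mnm1E m'k eq_sym (negbTE kl).
case: odd; rewrite ?expr0 ?expr1 ?mul1r ?mulN1r ?mulNr; last by apply: h; apply: hu.
by rewrite (perm_mem (msuppN _)); apply: h; apply: hu.
Qed.

(** Compare the coefficients of the monomials divisible by [X_k]: none of them occurs in [v]. *)
Lemma mulX_free_eq0 n k (u v : 'rV[S]_n) : free_of k v -> 'X_k *: u + v = 0 -> u = 0.
Proof.
move=> hv uv; apply/rowP=> b; rewrite [RHS]mxE; apply/mpolyP => m; rewrite mcoeff0.
have /(congr1 (fun w : 'rV[S]_n => (w 0 b)@_(U_(k) + m)%MM)) := uv.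
rewrite !mxE mcoeffD mcoeff0 mulrC mcoeffMX [X in _ + X]memN_msupp_eq0 ?addr0 //.
by apply/negP => /hv; rewrite mnmDE mnm1E eqxx.
Qed.

(** The support of the remainder [p] lies in that of [f], so variables eliminated earlier do not
    come back. *)
Lemma split_variable (f : S) k : exists g p : S, f = 'X_k * g + p /\
  (forall m, m \in msupp p -> m \in msupp f /\ m k = 0%N).
Proof.
exists (\sum_(m <- msupp f | m k != 0%N) f@_m *: 'X_[m - U_(k)]).
exists (\sum_(m <- msupp f | ~~ (m k != 0%N)) f@_m *: 'X_[m]); split.
  rewrite {1}[f]mpolyE (bigID (fun m : 'X_{1..s} => m k != 0%N)) /=; congr (_ + _).
  rewrite mulr_sumr; apply: eq_bigr => m mk.
  rewrite -scalerAr -mpolyXD [(U_(k) + _)%MM]addmC submK //.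
  by apply/mnm_lepP => i; rewrite mnm1E; case: eqP => // <-; rewrite lt0n.
move=> m; rewrite mcoeff_msupp raddf_sum /= => h.
have /hasP[m' m'f /andP[m'k]] :
    has (fun m' : 'X_{1..s} => ~~ (m' k != 0%N) && (m' == m)) (msupp f).
  apply: contraNT h => /hasPn h; apply/eqP.
  rewrite big_seq_cond big1 // => m' /andP[m'f m'k].
  by have := h _ m'f; rewrite m'k /= mcoeffZ mcoeffX => /negbTE ->; rewrite mulr0.
by move=> /eqP <-; move: m'k; rewrite negbK => /eqP.
Qed.

Lemma vsplit_variable n (u : 'rV[S]_n) k : exists g p : 'rV[S]_n, u = 'X_k *: g + p /\
  (forall b m, m \in msupp (p 0 b) -> m \in msupp (u 0 b) /\ m k = 0%N).
Proof.
have [g Hg] := fin_all_exists (fun b => split_variable (u 0 b) k).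
have [p Hp] := fin_all_exists Hg.
exists (\row_b g b), (\row_b p b); split=> [|b m].
  by apply/rowP=> b; rewrite !mxE; have [] := Hp b.
by rewrite mxE; have [_] := Hp b; apply.
Qed.

Section Elimination.
Variables (n q : nat).
Implicit Types c : {set 'I_s} -> 'rV[S]_n.

(** The invariant of the elimination: a [q]-cycle involving none of the first [N] variables, neither
    in coefficients nor in exterior monomials. The last clause excludes constants, the only homology
    of the complex. *)
Definition eliminated N c :=
  [/\ forall A, #|A|.+1 = q -> koszul c A = 0,
      forall A, #|A| = q -> forall k, (k < N)%N -> free_of k (c A),
      forall A, #|A| = q -> forall k, (k < N)%N -> k \in A -> c A = 0 &
      q = 0%N -> forall b, (c set0 0 b)@_0%MM = 0].

(** Write [c = X_k g + p] with [p] free of [X_k]. Subtracting the boundary of [e_k /\ g] leaves [p]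
    plus [e_k] times the boundary of [g], and the cycle condition kills this on the sets containing
    [k]. *)
Lemma eliminate_variable k c : eliminated k c ->
  exists b, eliminated k.+1 (fun A => c A - koszul b A).
Proof.
move=> [cyc fre van con].
have [g Hg] := fin_all_exists (fun A => vsplit_variable (c A) k).
have [p Hp] := fin_all_exists Hg.
have pk A : free_of k (p A) by move=> b m /(proj2 (Hp A)) [].
exists (wedge k g).
have cE A : #|A| = q -> c A - koszul (wedge k g) A = p A + wedge k (koszul g) A.
  move=> _; rewrite {1}(proj1 (Hp A)) -(koszul_wedge k g A).
  by rewrite [LHS]addrC -addrA addKr addrC.
have cN A : #|A| = q -> k \notin A -> c A - koszul (wedge k g) A = p A.
  by move=> Aq kA; rewrite cE // /wedge (negbTE kA) addr0.
have cY A : #|A| = q -> k \in A -> c A - koszul (wedge k g) A = 0.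
  move=> Aq kA; rewrite cE // /wedge kA; set B := A :\ k.
  have kB : k \notin B by rewrite !inE eqxx.
  have AE : A = k |: B by rewrite setD1K.
  have Bq : #|B|.+1 = q by rewrite -Aq AE cardsU1 kB.
  rewrite -[p A]scale1r -(ksignK K k B) -scalerA -scalerDr.
  rewrite (_ : _ + _ = 0) ?scaler0 //.
  (* [X_k] times the vector in question, plus terms free of [X_k], is the boundary of [c] at [B],
     which is zero. *)
  apply: (@mulX_free_eq0 _ k _ (\sum_(l | (l \notin B) && (l != k))
     (ksign K l B * 'X_l) *: p (l |: B))).
    elim/big_ind: _ => [||l /andP[_ lk]]; [exact: free_of0 | exact: free_ofD |].
    by apply: free_ofZX (pk _); rewrite eq_sym.
  transitivity (koszul c B); last exact: cyc.
  have -> : koszul c B = 'X_k *: koszul g B + koszul p B.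
    rewrite scaler_sumr -big_split; apply: eq_bigr => i _ /=.
    by rewrite (proj1 (Hp (i |: B))) scalerDr !scalerA; congr (_ *: _ + _); ring.
  rewrite [koszul p B](bigD1 k) //= -AE scalerDr scalerA ['X_k * _]mulrC.
 by rewrite [RHS]addrCA -addrA.
split.
- by move=> A Aq; rewrite koszulB koszulK subr0 cyc.
- move=> A Aq l; rewrite ltnS leq_eqVlt => /orP[/eqP/val_inj ->|lk].
    by case: (boolP (k \in A)) => kA; [rewrite cY //; apply: free_of0 | rewrite cN].
  case: (boolP (k \in A)) => kA; [by rewrite cY //; apply: free_of0 | rewrite cN //].
  by move=> b m /(proj2 (Hp A)) [/(fre A Aq l lk)].
- move=> A Aq l; rewrite ltnS leq_eqVlt => /orP[/eqP/val_inj ->|lk] lA.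
    by rewrite cY.
  case: (boolP (k \in A)) => kA; first by rewrite cY.
  rewrite cN //; apply/rowP => b; rewrite mxE; apply/eqP; rewrite -msupp_eq0.
  case E: (msupp _) => [//|m r].
  have [] := proj2 (Hp A) b m; first by rewrite E inE eqxx.
  by rewrite (van A Aq l lk lA) mxE msupp0.
- move=> q0 b; rewrite cN ?cards0 ?inE //; apply: memN_msupp_eq0.
  by apply/negP=> /(proj2 (Hp _)) []; rewrite mcoeff_msupp con ?eqxx.
Qed.

Lemma koszul_exact c :
  (forall A, #|A|.+1 = q -> koszul c A = 0) ->
  (q = 0%N -> forall b, (c set0 0 b)@_0%MM = 0) ->
  exists b, forall A, #|A| = q -> c A = koszul b A.
Proof.
move=> cyc con.
have /(_ s (leqnn s)) [b [c' [[_ fre van con'] cE]]] : forall N, (N <= s)%N ->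
    exists b c', eliminated N c' /\ forall A, c A = c' A + koszul b A.
  elim=> [_|N IH Ns].
    exists (fun=> 0), c; split; first by split.
    by move=> A; rewrite /koszul big1 ?addr0 // => k _; rewrite scaler0.
  have [b [c' [hc' cE]]] := IH (ltnW Ns).
  have [b' hb'] := @eliminate_variable (Ordinal Ns) _ hc'.
  exists (fun A => b A + b' A); exists (fun A => c' A - koszul b' A); split=> // A.
  by rewrite koszulD cE addrCA addrNK addrC.
(* With all variables eliminated, [c'] vanishes on nonempty sets, and on the empty set it is a
   constant, which [con'] excludes. *)
exists b => A Aq; rewrite cE -[RHS]add0r; congr (_ + _).
have [A0|[k kA]] := set_0Vmem A; last exact: van _ kA.
rewrite A0 in Aq *; apply/rowP=> i; rewrite [RHS]mxE; apply/mpolyP=> m; rewrite mcoeff0.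
have [->|m0] := eqVneq m 0%MM; first by apply: con'; rewrite -Aq cards0.
apply: memN_msupp_eq0; apply: contra m0 => hm; apply/eqP/mnmP=> k.
by rewrite mnm0E (fre _ Aq k _ i).
Qed.

End Elimination.
End KoszulExact.

(** * Koszul homology and the generator degrees of a minimal resolution *)

Section KoszulHomology.
Variables (K : fieldType) (s : nat) (I : {mpoly K[s]} -> Prop) (F : min_resolution I).
Local Notation S := {mpoly K[s]}.
Implicit Types (A : {set 'I_s}) (i q : nat) (d : int).

Definition image_diff i (u : 'rV[S]_(res_rank F i)) := exists w, u = w *m res_diff F i.

Lemma image_diff0 i : image_diff (0 : 'rV_(res_rank F i)).
Proof. by exists 0; rewrite mul0mx. Qed.

Lemma image_diffD i (u v : 'rV_(res_rank F i)) :
  image_diff u -> image_diff v -> image_diff (u + v).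
Proof. by move=> [w ->] [w' ->]; exists (w + w'); rewrite mulmxDl. Qed.

Lemma image_diffZ i f (u : 'rV_(res_rank F i)) : image_diff u -> image_diff (f *: u).
Proof. by move=> [w ->]; exists (f *: w); rewrite scalemxAl. Qed.

Lemma image_diffN i (u : 'rV_(res_rank F i)) : image_diff u -> image_diff (- u).
Proof. by rewrite -scaleN1r; apply: image_diffZ. Qed.

Lemma image_diff_vcomp i d (u : 'rV_(res_rank F i)) :
  image_diff u -> image_diff (vcomp (@res_shift _ _ _ F i) d u).
Proof.
move=> [w ->]; exists (vcomp (@res_shift _ _ _ F i.+1) d w).
by rewrite (vcomp_mulmx (@res_diff_graded _ _ _ F i)).
Qed.

Lemma image_diff_koszul i q A (c : {set 'I_s} -> 'rV_(res_rank F i)) :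
  #|A|.+1 = q -> (forall B : {set _}, #|B| = q -> image_diff (c B)) ->
  image_diff (koszul c A).
Proof.
move=> Aq hc; apply: (big_ind (@image_diff i)) => [||k kA].
- exact: image_diff0.
- exact: image_diffD.
- by apply/image_diffZ/hc; rewrite cardsU1 kA -Aq.
Qed.

Lemma res_diffP i (u : 'rV_(res_rank F i.+1)) : u *m res_diff F i = 0 <-> image_diff u.
Proof. exact: res_exact. Qed.

(* The degree [d] part of the [q]-th Koszul homology of [F_i / im F_(i+1)] is zero. *)
Definition koszul_acyclic i q d :=
  forall c : {set 'I_s} -> 'rV_(res_rank F i),
    (forall A, #|A| = q -> vhomog (@res_shift _ _ _ F i) (d - q%:Z) (c A)) ->
    (forall A, #|A|.+1 = q -> image_diff (koszul c A)) ->
  exists b, forall A, #|A| = q -> image_diff (c A - koszul b A).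

Lemma coef0_mul_diff i (w : 'rV_(res_rank F i.+1)) b :
  ((w *m res_diff F i) 0 b)@_0%MM = 0.
Proof.
by rewrite mxE raddf_sum big1 // => a _; rewrite /= rmorphM /= res_minimal mulr0.
Qed.

(** Let [M_i] be [F_i / im F_(i+1)]; then [M_(i+1)] embeds in [F_i] with quotient [M_i]. A [q]-cycle
    of [M_(i+1)] bounds in [F_i], for [q = 0] thanks to minimality, and the bounding chain is a
    [q.+1]-cycle of [M_i]. *)
Lemma koszul_acyclic_up i q d : koszul_acyclic i q.+1 d -> koszul_acyclic i.+1 q d.
Proof.
move=> acy c hc cyc.
have [A Aq|q0 b|b hb] := @koszul_exact _ _ _ q (fun A => c A *m res_diff F i).
- by rewrite koszul_mulmx; apply/res_diffP/cyc.
- exact: coef0_mul_diff.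
(* The hypothesis [acy] concerns homogeneous chains, so [b] is replaced by its component of the
   right degree. *)
pose b' A := vcomp (@res_shift _ _ _ F i) (d - q%:Z - 1) (b A).
have b'E A : #|A| = q -> koszul b' A = c A *m res_diff F i.
  move=> Aq; rewrite koszul_vcomp -hb // vcomp_id //.
  by apply: (vhomog_mulmx (@res_diff_graded _ _ _ F i)); apply: hc.
have [A Aq|A [Aq]|e he] := acy b'.
- by rewrite -addn1 PoszD opprD addrA; apply: vcomp_vhomog.
- by exists (c A); apply: b'E.
have [w hw] := fin_choice_on 0 (fun A (Aq : #|A| == q.+1) => he A (eqP Aq)).
exists w => A Aq; apply/res_diffP.
rewrite mulmxBl -b'E // -koszul_mulmx -koszulB -[RHS](koszulK e A).
by apply: (eq_koszul Aq) => B Bq; rewrite -hw ?Bq // opprB addrC addrNK.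
Qed.

(** The boundary of a [q.+1]-cycle of [M_i] comes from a [q]-cycle of [M_(i+1)]. Once the latter
    bounds, [c] can be corrected to a cycle of [F_i], which is a boundary. *)
Lemma koszul_acyclic_down i q d : koszul_acyclic i.+1 q d -> koszul_acyclic i q.+1 d.
Proof.
move=> acy c hc cyc.
have [A Aq|e he] := @fin_choice_on _ _ 0 (fun A => #|A| == q)
    (fun A w => koszul c A = w *m res_diff F i).
  by apply: cyc; rewrite (eqP Aq).
pose e' A := vcomp (@res_shift _ _ _ F i.+1) (d - q%:Z) (e A).
have e'E A : #|A| = q -> e' A *m res_diff F i = koszul c A.
  move=> Aq; rewrite -(vcomp_mulmx (@res_diff_graded _ _ _ F i)) -he ?Aq ?eqxx //.
  by rewrite vcomp_id //; apply: koszul_vhomog.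
have [A Aq|A Aq|b hb] := acy e'.
- exact: vcomp_vhomog.
- apply/res_diffP; rewrite -koszul_mulmx -[RHS](koszulK c A).
  by apply: (eq_koszul erefl) => B Bq; apply: e'E; rewrite Bq.
have [A [Aq]|//|b' hb'] := @koszul_exact _ _ _ q.+1 (fun A => c A - b A *m res_diff F i).
  rewrite koszulB koszul_mulmx -e'E // -mulmxBl.
  exact/res_diffP/hb.
by exists b' => A Aq; exists (b A); rewrite -hb' // opprB addrCA subrr addr0.
Qed.

Lemma koszul_acyclic_shift i q d : koszul_acyclic 0 (i + q) d <-> koszul_acyclic i q d.
Proof.
elim: i q => [|i IH] q; first by [].
rewrite addSnnS IH; split; [exact: koszul_acyclic_up | exact: koszul_acyclic_down].
Qed.

(** Dimension shifting leads to the zeroth homology of [M_q], which by minimality is [F_q] modulo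
    the variables, with the basis vectors of [F_q] as a basis over [K]. *)
Lemma koszul_acyclicP q d :
  koszul_acyclic 0 q d <-> forall b : 'I_(res_rank F q), res_shift b != d.
Proof.
rewrite -[in X in X <-> _](addn0 q) koszul_acyclic_shift; split=> [acy b|sh c hc _].
  apply/eqP=> bd.
  (* The basis vector [b] as a 0-chain: its constant coefficient 1 comes neither from the image of
     [F_(q+1)] nor from a Koszul boundary. *)
  have [A /eqP A0|//|e he] := acy (fun=> delta_mx 0 b).
    move=> a; rewrite subr0 mxE eqxx /=; case: eqP => [->|_]; last exact: homogz0.
    by rewrite bd subrr /=; apply: dhomog1.
  have [w /rowP/(_ b)/(congr1 (mcoeff 0%MM))] := he set0 (cards0 _).
  rewrite coef0_mul_diff !mxE !eqxx mcoeffB summxE raddf_sum big1 ?subr0.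
    by rewrite mcoeff1 eqxx => /eqP; rewrite oner_eq0.
  move=> k _; rewrite /= mxE rmorphM /= (homogz_coef0 (ksign_homogz K k _)) ?mul0r //.
(* Without a generator of degree [d], vectors of degree [d] have no constant terms. *)
have [A //|_ b|b hb] := @koszul_exact _ _ _ 0%N c.
  apply: (homogz_coef0 (hc set0 (cards0 _) b)).
  by rewrite subr0 subr_eq0 eq_sym.
by exists b => A Aq; rewrite hb // subrr; apply: image_diff0.
Qed.

End KoszulHomology.

(** * Vanishing modulo a regular variable versus generator degrees *)

Section RegularElement.
Variables (K : fieldType) (s : nat) (I : {mpoly K[s]} -> Prop).
Local Notation S := {mpoly K[s]}.
Hypothesis I_sub : forall f g, I f -> I g -> I (f - g).
Hypothesis I_mulX : forall k f, I f -> I ('X_k * f).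
Hypothesis I_regX : forall k f, I ('X_k * f) -> I f.
Hypothesis I_hcomp : forall d f, I f -> I (hcomp d f).
Variables (F : min_resolution I) (k0 : 'I_s).
Implicit Types (A : {set 'I_s}) (q : nat) (d r : int).

(* [S/(I, X_k0)] vanishes in degree [d]. *)
Definition quot_vanishes d := forall f, homogz d f -> exists g, I (f - 'X_k0 * g).

Let aug (u : 'rV[S]_(res_rank F 0)) : S := (u *m res_aug F) 0 0.
Let shift0 := @res_shift _ _ _ F 0.

Lemma aug_imageP u : I (aug u) <-> image_diff u.
Proof. exact: res_exact0. Qed.

Lemma augB u v : aug (u - v) = aug u - aug v.
Proof. by rewrite /aug mulmxBl !mxE. Qed.

Lemma augZ f u : aug (f *: u) = f * aug u.
Proof. by rewrite /aug -scalemxAl !mxE. Qed.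

Lemma res_aug_graded_matrix a (b : 'I_1) : homogz (shift0 a - 0) (res_aug F a b).
Proof. by rewrite subr0 ord1; apply: res_aug_graded. Qed.

Lemma hcomp_aug d u : hcomp d (aug u) = aug (vcomp shift0 d u).
Proof.
rewrite /aug -(@vcomp_mulmx _ _ _ _ _ (fun=> 0) _ res_aug_graded_matrix).
by rewrite [in RHS]mxE subr0.
Qed.

Lemma ideal_add f g : I f -> I g -> I (f + g).
Proof.
move=> If Ig; rewrite -[g]opprK; apply: I_sub => //.
by rewrite -sub0r; apply: I_sub => //; rewrite -(subrr g); apply: I_sub.
Qed.

Lemma image_diff_regX k u : image_diff ('X_k *: u) -> @image_diff _ _ _ F 0 u.
Proof. by move=> /aug_imageP; rewrite augZ => /I_regX /aug_imageP. Qed.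

(** Transfers the condition to [F_0 / im F_1], where the Koszul chains have their coefficients. *)
Lemma quot_vanishesP d : quot_vanishes d <->
  forall u, vhomog shift0 d u -> exists g, image_diff (u - 'X_k0 *: g).
Proof.
split=> [van u hu|van f hf].
  have [|g hg] := van (aug u).
    by rewrite -(vcomp_id hu) -hcomp_aug; apply: hcomp_homogz.
  have [v hv] := res_aug_surj F g.
  exists v; apply/aug_imageP; rewrite augB augZ.
  rewrite (_ : _ - _ = aug u - 'X_k0 * g + 'X_k0 * (g - aug v)); last by ring.
  by apply: ideal_add => //; apply: I_mulX.
have [u hu] := res_aug_surj F f.
have [|v hv] := van (vcomp shift0 d u); first exact: vcomp_vhomog.
exists (aug v).
rewrite (_ : _ - _ = hcomp d (f - aug u) + aug (vcomp shift0 d u - 'X_k0 *: v)).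
  by apply: ideal_add; [apply: I_hcomp | apply/aug_imageP].
by rewrite raddfB /= hcomp_aug hcomp_id // augB augZ; ring.
Qed.

Lemma quot_vanishes_pred d :
  koszul_acyclic F 0 s.-1 (d + s.-1%:Z) -> quot_vanishes (d + 1) -> quot_vanishes d.
Proof.
move=> acy /quot_vanishesP van; apply/quot_vanishesP => z hz.
(* The value of [y] at [k0] is prescribed, so that [z] itself is a coefficient of the cycle
   below. *)
have /fin_all_exists[y hy] : forall k, exists y, [/\ vhomog shift0 d y,
    image_diff ('X_k *: z - 'X_k0 *: y) & k = k0 -> y = z].
  move=> k; have [->|kk0] := eqVneq k k0.
    by exists z; split=> //; rewrite subrr; apply: image_diff0.
  have [|g /(image_diff_vcomp (d + 1)) hg] := van ('X_k *: z).
    exact: vhomogZ (homogzX K k) hz.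
  exists (vcomp shift0 d g); split; [exact: vcomp_vhomog | | by move/eqP: kk0].
  move: hg; rewrite raddfB /= !(vcompZ _ _ _ (homogzX K _)) addrK.
  by rewrite (vcomp_id hz).
(* Multiplied by [X_k0], both terms become [X_i X_k z] modulo the image; then [X_k0] is
   cancelled. *)
have yX i k : image_diff ('X_i *: y k - 'X_k *: y i).
  apply: (@image_diff_regX k0); have [_ hi _] := hy i; have [_ hk _] := hy k.
  rewrite (_ : _ *: _ = 'X_k *: ('X_i *: z - 'X_k0 *: y i)
                      - 'X_i *: ('X_k *: z - 'X_k0 *: y k)).
    by apply: image_diffD; [|apply: image_diffN]; apply: image_diffZ.
  rewrite !scalerBr !scalerA ['X_k * 'X_i]mulrC opprB [RHS]addrC addrA addrNK.
  by congr (_ *: _ - _ *: _); rewrite mulrC.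
(* On a set missing one index [k], only the term of [y k] is present. *)
pose c A := \sum_(k | k \notin A) ksign K k A *: y k.
have [A Aq|A Aq|b hb] := acy c.
- apply: vhomog_sum => k _; rewrite addrK -[d]addr0.
  apply: vhomogZ; first exact: homogz_sign.
  by have [] := hy k.
(* A set of size [s - 2] misses two indices, and the boundary there is, up to sign, the difference
   in [yX]. *)
- have /eqP/cards2P[i [k [ik AE]]] : #|~: A| = 2%N.
    apply/eqP; rewrite -(eqn_add2l #|A|) cardsC card_ord addn2 Aq prednK //.
    by rewrite (leq_trans _ (ltn_ord k0)).
  have inA l : (l \notin A) = (l \in [set i; k]) by rewrite -AE inE.
  have iA : i \notin A by rewrite inA !inE eqxx.
  have kA : k \notin A by rewrite inA !inE eqxx orbT.
  have cE a b : a != b -> a \notin A -> b \notin A ->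
      c (a |: A) = ksign K b (a |: A) *: y b.
    move=> ab aA bA; rewrite /c (bigD1 b) /=; last by rewrite !inE negb_or eq_sym ab.
    rewrite big1 ?addr0 // => l; rewrite !inE negb_or inA !inE => /andP[/andP[la lik] lb].
    move: aA bA ab la lik lb; rewrite !inA !inE.
    move=> /orP[]/eqP-> /orP[]/eqP->; rewrite ?eqxx // => _ la;
      by rewrite (negbTE la) ?orbF /= => /eqP->; rewrite eqxx.
  rewrite /koszul (bigD1 i) //= (bigD1 k) /=; last by rewrite kA eq_sym.
  rewrite big1 ?addr0 => [|l /andP[/andP[]]]; last first.
    by rewrite inA !inE => /orP[]->.
  rewrite (cE i k) // (cE k i) 1?eq_sym //.
  rewrite (_ : _ + _ = (ksign K i A * ksign K k (i |: A)) *: ('X_i *: y k - 'X_k *: y i)).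
    exact: image_diffZ.
  rewrite scalerBr !scalerA -scaleNr; congr (_ *: _ + _ *: _); first by ring.
  have ks := @ksign_swap K s i k A ik iA kA.
  by transitivity (ksign K i (k |: A) * ksign K k A * 'X_k); [|rewrite ks]; ring.
(* At this set [c] is [z] up to sign, while a boundary is a multiple of [X_k0]. *)
pose A := ~: [set k0].
have Aq : #|A| = s.-1.
  by have := cardsC [set k0]; rewrite cards1 card_ord => /(congr1 predn).
have k0A l : (l \notin A) = (l == k0) by rewrite !inE negbK.
exists (b (k0 |: A)); have := image_diffZ (ksign K k0 A) (hb A Aq).
rewrite (_ : c A = ksign K k0 A *: y k0); last exact: big_pred1.
rewrite (_ : koszul b A = (ksign K k0 A * 'X_k0) *: b (k0 |: A)); last exact: big_pred1.
rewrite scalerBr !scalerA mulrA ksignK scale1r mul1r.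
by have [_ _ ->] := hy k0.
Qed.

(** Descending induction on the degree from [N]: for [d > r], [F_(s-1)] has no generator of degree
    [d + s - 1]. *)
Lemma shift_le_quot_vanishes r : (exists N, forall d, N <= d -> quot_vanishes d) ->
  (forall q (b : 'I_(res_rank F q)), res_shift b <= q%:Z + r) ->
  forall d, r < d -> quot_vanishes d.
Proof.
move=> [N hN] hr.
suff H n : forall d, N - n%:Z <= d -> r < d -> quot_vanishes d.
  move=> d; apply: (H `|N - d|%N).
  by rewrite abszE lerBlDl -lerBlDr; apply: ler_norm.
elim: n => [|n IH] d Nd rd; first by apply: hN; rewrite -[N]subr0.
apply: quot_vanishes_pred.
  apply/koszul_acyclicP => b; rewrite lt_eqF //.
  by apply: le_lt_trans (hr _ b) _; rewrite addrC ltrD2r.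
apply: IH; last by rewrite (lt_trans rd) // ltrDl.
by move: Nd; rewrite -addn1 PoszD opprD addrA lerBlDr.
Qed.

Lemma quot_vanishes_shift_le r : (forall d, r < d -> quot_vanishes d) ->
  forall q (b : 'I_(res_rank F q)), res_shift b <= q%:Z + r.
Proof.
move=> van q b; rewrite leNgt; apply/negP => rb.
suff /koszul_acyclicP/(_ b) : koszul_acyclic F 0 q (res_shift b) by rewrite eqxx.
move: (res_shift b) rb => d rd c hc cyc.
have rd' : r < d - q%:Z by rewrite ltrBrDr addrC.
have [A /eqP Aq|g hg] := @fin_choice_on _ _ 0 (fun A => #|A| == q)
    (fun A g => image_diff (c A - 'X_k0 *: g)).
  by have /quot_vanishesP := van _ rd'; apply; apply: hc.
(* As [X_k0 g] agrees with the cycle [c] modulo the image, cancelling [X_k0] makes [g] a cycle. *)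
have gcyc A : #|A|.+1 = q -> image_diff (koszul g A).
  move=> Aq; apply: (@image_diff_regX k0).
  rewrite (_ : _ *: _ = koszul c A - koszul (fun B => c B - 'X_k0 *: g B) A).
    apply: image_diffD; first exact: cyc.
    by apply: image_diffN; apply: (image_diff_koszul Aq) => B Bq; apply: hg; rewrite Bq.
  rewrite koszulB opprB addrCA subrr addr0 scaler_sumr; apply: eq_bigr => k _.
  by rewrite !scalerA mulrC.
(* By the homotopy formula, [X_k0 g] is the boundary of [e_k0 /\ g] up to [e_k0] times the boundary
   of [g]. *)
exists (wedge k0 g) => A Aq.
rewrite (_ : _ - _ = (c A - 'X_k0 *: g A) + wedge k0 (koszul g) A).
  apply: image_diffD; first by apply: hg; rewrite Aq.
  rewrite /wedge; case: ifP => kA; last exact: image_diff0.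
  by apply/image_diffZ/gcyc; rewrite -Aq (cardsD1 k0 A) kA.
by rewrite -(koszul_wedge k0 g A) opprD addrA addrNK.
Qed.

End RegularElement.

(** * The vanishing ideal of a toric set *)

Section VanishingIdeal.
Variables (K : fieldType) (G : multigraph).
Local Notation S := {mpoly K[nedges G]}.
Local Notation I := (@vanishing_ideal K G).

(** A component of [a * g] with [g] homogeneous is a component of [a] times [g]; conversely, the
    components of [f] serve as generators. *)
Lemma vanishing_idealP (f : S) :
  I f <-> forall d y, toric_set y -> (hcomp d f).@[y] = 0.
Proof.
split=> [[m [a [g [hg ->]]]] d y hy|van].
  rewrite !raddf_sum big1 // => k _ /=; have [[e he] gv] := hg k.
  by rewrite (@hcompMr _ _ _ e%:Z) // mevalM gv // mulr0.
exists (msize f), (fun=> 1), (fun k => hcomp (k : nat)%:Z f); split.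
  move=> k; split=> [|y hy]; last exact: van.
  by exists k; apply: (hcomp_homogz k%:Z).
by rewrite [LHS]hcomp_sum; apply: eq_bigr => k _; rewrite mul1r.
Qed.

Lemma vanishing_ideal_sub (f g : S) : I f -> I g -> I (f - g).
Proof.
move=> /vanishing_idealP hf /vanishing_idealP hg; apply/vanishing_idealP => d y hy.
by rewrite raddfB /= mevalB hf // hg // subr0.
Qed.

Lemma vanishing_idealM_homogz d (f g : S) : homogz d g -> I f -> I (f * g).
Proof.
move=> hg /vanishing_idealP hf; apply/vanishing_idealP => e y hy.
by rewrite (hcompMr _ _ hg) mevalM hf // mul0r.
Qed.

Lemma vanishing_ideal_mulX k (f : S) : I f -> I ('X_k * f).
Proof. by rewrite mulrC; apply: vanishing_idealM_homogz (homogzX K k). Qed.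

Lemma toric_set_neq0 (y : 'I_(nedges G) -> K) k : toric_set y -> y k != 0.
Proof.
move=> [x x0 [c c0 ->]]; rewrite mulf_neq0 //.
by apply/prodf_neq0 => v _; apply: x0.
Qed.

(** Points of the toric set have nonzero coordinates, so the value of [X_k] can be cancelled. *)
Lemma vanishing_ideal_regX k (f : S) : I ('X_k * f) -> I f.
Proof.
move=> /vanishing_idealP hf; apply/vanishing_idealP => d y hy.
apply/eqP; have /eqP := hf (d + 1) y hy.
rewrite mulrC (hcompMr _ _ (homogzX K k)) addrK mevalM mulf_eq0 mevalXU.
by rewrite (negbTE (toric_set_neq0 k hy)) orbF.
Qed.

Lemma vanishing_ideal_hcomp d (f : S) : I f -> I (hcomp d f).
Proof.
move=> /vanishing_idealP hf; apply/vanishing_idealP => e y hy.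
have [<-|de] := eqVneq d e; first by rewrite hcomp_id ?hf //; apply: hcomp_homogz.
by rewrite (hcomp_neq (hcomp_homogz d f)) // meval0.
Qed.

End VanishingIdeal.

(** * Vanishing in large degrees over a finite field *)

Section FiniteField.
Variables (K : finFieldType) (G : multigraph).
Local Notation S := {mpoly K[nedges G]}.
Local Notation I := (@vanishing_ideal K G).

Lemma vanishing_ideal_frobenius (i k : 'I_(nedges G)) :
  I ('X_i ^+ #|K| - 'X_k * ('X_k ^+ #|K|.-2 * 'X_i) : S).
Proof.
have [n nE] : exists n, #|K| = n.+2.
  by exists #|K|.-2; case: #|K| (finNzRing_gt1 K) => [|[|n]].
(* The extra factor [X_k] lets [y k ^+ #|K| = y k] be used without division. *)
apply: (@vanishing_ideal_regX _ _ k); apply/vanishing_idealP => d y hy.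
set f := 'X_k * _.
have hf : homogz (n.+3%:Z) f.
  have hX j l : ('X_j ^+ l : S) \is l.-homog.
    by rewrite -[l in l.-homog]mul1n; apply: dhomogMn; apply: (homogzX K j).
  rewrite /f nE /= mulrBr; apply: rpredB; first exact: (dhomogM (hX k 1%N) (hX i n.+2)).
  rewrite (_ : n.+3 = (1 + (1 + (n + 1)))%N); last by rewrite addn1.
  exact: (dhomogM (hX k 1%N) (dhomogM (hX k 1%N) (dhomogM (hX k n) (hX i 1%N)))).
have [dE|dn] := eqVneq (n.+3%:Z) d; last by rewrite (hcomp_neq hf) // meval0.
have yK j : y j ^+ n.+2 = y j by rewrite -nE expf_card.
rewrite hcomp_id -?dE // /f mevalM mevalB !mevalM !rmorphXn /= !mevalXU nE yK /=.
have -> : y k * (y k ^+ n * y i) = y k ^+ n.+1 * y i by rewrite mulrA -exprS.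
by rewrite mulrBr [_ * (_ ^+ _ * _)]mulrA -exprS yK subrr.
Qed.

Lemma vanishing_ideal_quot_vanishes (k : 'I_(nedges G)) :
  exists N, forall d, N <= d -> quot_vanishes I k d.
Proof.
exists (nedges G * #|K|).+1%:Z => -[d|//] dN f hf.
have key (m : 'X_{1..nedges G}) : mdeg m = d -> exists g : S, I ('X_[m] - 'X_k * g).
  move=> md.
  (* Were all exponents below [#|K|], the degree would be at most [nedges G * #|K|]; hence the
     choice of [N]. *)
  have /existsP[i qi] : [exists i, (#|K| <= m i)%N].
    apply: contraLR dN => /existsPn h; rewrite -md lez_nat -leqNgt mdegE.
    rewrite -[nedges G in leqRHS]card_ord -sum_nat_const; apply: leq_sum => i _.
    by have := h i; rewrite -ltnNge => /ltnW.
  exists ('X_k ^+ #|K|.-2 * 'X_i * 'X_[m - U_(i) *+ #|K|]).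
  rewrite (_ : _ - _ =
      ('X_i ^+ #|K| - 'X_k * ('X_k ^+ #|K|.-2 * 'X_i)) * 'X_[m - U_(i) *+ #|K|]).
    apply: (@vanishing_idealM_homogz _ _ (mdeg (m - U_(i) *+ #|K|))%:Z).
      by rewrite /= dhomogX.
    exact: vanishing_ideal_frobenius.
  rewrite mulrBl !mulrA; congr (_ - _).
  rewrite mpolyXn -mpolyXD addmC submK //; apply/mnm_lepP => j.
  by rewrite mulmnE mnm1E; case: eqP => [<-|_]; rewrite ?mul1n ?mul0n.
have : forall m, m \in msupp f -> exists g : S, I (f@_m *: 'X_[m] - 'X_k * g).
  move=> m mf; have [g hg] := key m (dhomog_mf hf mf).
  exists (f@_m *: g); rewrite -scalerAr -scalerBr -mul_mpolyC mulrC.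
  apply: (@vanishing_idealM_homogz _ _ 0) hg => /=.
  by rewrite -[_%:MP]mulr1 mul_mpolyC rpredZ // dhomog1.
move=> hs; rewrite [f]mpolyE big_seq.
apply: (big_ind (fun p : S => exists g, I (p - 'X_k * g))) => [|p p' [g hg] [g' hg']|//].
  exists 0; rewrite mulr0 subr0; apply/vanishing_idealP => e y _.
  by rewrite raddf0 meval0.
exists (g + g'); rewrite (_ : _ - _ = (p - 'X_k * g) + (p' - 'X_k * g')); last by ring.
by apply: ideal_add => //; apply: vanishing_ideal_sub.
Qed.


End FiniteField.

(** * Inclusion of the toric sets and of their ideals *)

Section IdentifyVertices.
Variables (K : fieldType) (G : multigraph) (v1 v2 : vertex G).
Variables (v12 : v1 != v2) (nadj : ~~ adjacent v1 v2).

(** Parameters on the new graph pull back to parameters with equal values at [v1] and [v2]. Edge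
    monomials agree because the projection is injective on each edge. *)
Lemma toric_set_identify (y : 'I_(nedges G) -> K) :
  @toric_set K (identify v12 nadj) y -> toric_set y.
Proof.
move=> [x x0 [c c0 yE]]; exists (x \o identify_proj v12); first by move=> v; apply: x0.
exists c => // e; rewrite yE; congr (_ * _).
apply: big_imset; apply/imset_injP.
by rewrite [#|_ @: _|](card_identify_ends v12 nadj) card_ends.
Qed.

Lemma vanishing_ideal_identify (f : {mpoly K[nedges G]}) :
  vanishing_ideal f -> @vanishing_ideal K (identify v12 nadj) f.
Proof.
move=> /vanishing_idealP van; apply/vanishing_idealP => d y hy.
exact/van/toric_set_identify.
Qed.

End IdentifyVertices.

(** * Comparison of the two regularities *)

Theorem proposition2p5 (K : finFieldType) (G : multigraph)
    (v1 v2 : vertex G) (v12 : v1 != v2) (nadj : ~~ adjacent v1 v2)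
    (r r' : int) :
  is_regularity (@vanishing_ideal K G) r ->
  is_regularity (@vanishing_ideal K (identify v12 nadj)) r' ->
  r >= r'.
Proof.
move=> [F [_ Fr]] [F' [[i [j [bij <-]]] _]].
(* Any variable serves, being a nonzerodivisor modulo both ideals. *)
have [k0 _] : exists k : 'I_(nedges G), True by exists (Ordinal (nedges_gt0 G)).
have shift_le q (b : 'I_(res_rank F q)) : res_shift b <= q%:Z + r.
  rewrite -lerBlDl; apply: Fr; rewrite -lt0n; apply/card_gt0P.
  by exists b; rewrite inE.
have van d : r < d -> quot_vanishes (@vanishing_ideal K G) k0 d.
  apply: (shift_le_quot_vanishes _ _ _ _ (vanishing_ideal_quot_vanishes K k0) shift_le).
  - exact: vanishing_ideal_sub.
  - exact: vanishing_ideal_mulX.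
  - exact: vanishing_ideal_regX.
  - exact: vanishing_ideal_hcomp.
have van' d : r < d -> quot_vanishes (@vanishing_ideal K (identify v12 nadj)) k0 d.
  by move=> /van vd f /vd [g hg]; exists g; apply: vanishing_ideal_identify.
(* Here [b] is a generator of the second resolution at which [r'] is attained. *)
move: bij; rewrite -lt0n => /card_gt0P[b]; rewrite inE => /eqP <-; rewrite lerBlDl.
apply: (quot_vanishes_shift_le _ _ _ _ van').
- exact: vanishing_ideal_sub.
- exact: vanishing_ideal_mulX.
- exact: vanishing_ideal_regX.
- exact: vanishing_ideal_hcomp.
Qed.
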